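(* Let $(X,d)$ be a (nonempty) complete metric space, let $\psi,\phi:(0,\infty)\to\mathbb{R}$ be nondecreasing functions, and let $w:X\to X$ be a continuous map such that $$\psi(d(w(x),w(y)))\le\phi(d(x,y))\quad\text{for all }x,y\in X\text{ with }d(w(x),w(y))>0.$$ Suppose that: (i) $\phi(t)<\psi(t)$ for any $t>0$; (ii) $\inf_{t>\epsilon}\psi(t)>-\infty$ for any $\epsilon>0$; (iii) if $\{t_n\}\subset(0,\infty)$ is a sequence such that $\{\psi(t_n)\}$ and $\{\phi(t_n)\}$ are convergent sequences with the same limit and $\{\psi(t_n)\}$ is strictly decreasing, then $t_n\to0$ as $n\to\infty$; (iv) $\limsup_{t\to\epsilon+}\phi(t)<\liminf_{t\to\epsilon+}\psi(t)$ for any $\epsilon>0$. Then there exists a unique attractor $A^*\in\mathcal{H}(X)$ for $w$, i.e. a unique $A^*\in\mathcal{H}(X)$ with $w(A^* )=A^*$. Moreover, for any $A\in\mathcal{H}(X)$ the sequence $\{A_n\}$ in $\mathcal{H}(X)$ given by $A_n=w^n(A)$ converges to $A^*$ in $(\mathcal{H}(X),h_d)$.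
   Context: $\mathcal{H}(X)$ is the set of all nonempty compact subsets of $X$, with the Hausdorff metric $h_d(A,B)=\max\{\max_{x\in A}\min_{y\in B}d(x,y),\ \max_{x\in B}\min_{y\in A}d(x,y)\}$. For $A\subseteq X$, $w(A)=\{w(a):a\in A\}$, and $w^n(A)$ is the image of $A$ under the $n$-fold composition of $w$. *)

(* Defs.v *)
From HB Require Import structures.
From mathcomp Require Import all_boot all_order all_algebra.
From mathcomp Require Import all_classical all_reals all_analysis.

Set Implicit Arguments.
Unset Strict Implicit.
Unset Printing Implicit Defensive.

Import Order.TTheory GRing.Theory Num.Theory.
Import numFieldNormedType.Exports.

Local Open Scope classical_set_scope.
Local Open Scope ring_scope.

(* [Complete] includes a base point, so a [completeMetricType] is a nonempty
   complete metric space. *)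
#[short(type="completeMetricType")]
HB.structure Definition CompleteMetric (K : numDomainType) :=
  { M of Metric K M & Complete M }.

Definition hyperspace (X : topologicalType) : set (set X) :=
  [set A | A !=set0 /\ compact A].

(* On real numbers, [sup] and [inf] return a junk value when the supremum or
   infimum does not exist.  On [hyperspace X] both exist and are attained, so
   that the expression below is the usual one with max and min. *)
Definition excess (R : realType) (X : metricType R) (A B : set X) : R :=
  sup [set inf [set mdist x y | y in B] | x in A].

Definition hausdorff_dist (R : realType) (X : metricType R) (A B : set X) : R :=
  Num.max (excess A B) (excess B A).

Definition attractor (X : topologicalType) (w : X -> X) (A : set X) : Prop :=
  hyperspace A /\ w @` A = A.

(* Main.v *)
(* By (iv), [w] satisfies a Meir-Keeler condition: for each [eps > 0] there is
   [delta > 0] such that [mdist x y < eps + delta] forces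
   [mdist (w x) (w y) <= eps]; by (i) and the monotonicity of [psi] it also
   shrinks all positive distances.  The iterates of any two points therefore
   approach each other, [w] has a fixed point [p] attracting every orbit, and
   by compactness (as in Dini's theorem) the orbits issued from a compact set
   converge to [p] uniformly.  The attractor is thus [[set p]]: an invariant
   compact set is equal to all its iterates, hence contained in every ball
   around [p]. *)
Require Import Defs.
From mathcomp Require Import all_boot all_order all_algebra.
From mathcomp Require Import all_classical all_reals all_analysis.

Set Implicit Arguments.
Unset Strict Implicit.
Unset Printing Implicit Defensive.

Import Order.TTheory GRing.Theory Num.Theory.
Import numFieldNormedType.Exports.

Local Open Scope classical_set_scope.
Local Open Scope ring_scope.

Section MeirKeeler.
Context {R : realType}.

Definition shrinking (X : metricType R) (w : X -> X) :=
  forall x y, x != y -> mdist (w x) (w y) < mdist x y.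

(** The bound is [<= eps], not the classical [< eps]: a condition on right limits at [eps] only
    excludes distances above [eps]. Strictness is supplied by [shrinking]. *)
Definition meir_keeler (X : metricType R) (w : X -> X) :=
  forall eps : R, 0 < eps -> exists2 delta, 0 < delta &
    forall x y, mdist x y < eps + delta -> mdist (w x) (w y) <= eps.

Section Iterates.
Context {X : metricType R} {w : X -> X}.
Hypothesis w_shrinking : shrinking w.

Lemma shrinking_le x y : mdist (w x) (w y) <= mdist x y.
Proof.
have [->|xy] := eqVneq x y; first by rewrite !mdistxx.
exact/ltW/w_shrinking.
Qed.

Lemma shrinking_iter_le x y m n : (m <= n)%N ->
  mdist (iter n w x) (iter n w y) <= mdist (iter m w x) (iter m w y).
Proof.
move=> /subnK <-; elim: (n - m)%N => [//|k IH].
by rewrite addSn /=; exact: le_trans (shrinking_le _ _) IH.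
Qed.

Hypothesis w_mk : meir_keeler w.

(** If the infimum [r] of the distances were positive, the Meir-Keeler condition at [r] would bring
    some distance down to [r], and one more strict shrinking would take it below. *)
Lemma iter_mdist_lt x y (eps : R) : 0 < eps ->
  exists n, mdist (iter n w x) (iter n w y) < eps.
Proof.
move=> eps0; pose d n := mdist (iter n w x) (iter n w y).
pose r := inf (range d).
have d_inf : has_inf (range d).
  by split; [exists (d 0%N); exists 0%N | exists 0 => _ [n _ <-]; exact: mdist_ge0].
have r_le n : r <= d n by apply: ge_inf; [exact: d_inf.2 | exists n].
suff r0 : r <= 0.
  have [_ [n _ <-] dn] := inf_adherent eps0 d_inf.
  by exists n; apply: (lt_le_trans dn); rewrite gerDr.
rewrite leNgt; apply/negP => r_gt0.
have [delta delta0 mk] := w_mk r_gt0.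
have [_ [n _ <-] dn] := inf_adherent delta0 d_inf.
have dn1 : d n.+1 <= r by exact: mk.
have ne : iter n.+1 w x != iter n.+1 w y.
  by rewrite -mdist_gt0; exact: lt_le_trans (r_le n.+1).
by have := lt_le_trans (w_shrinking ne) dn1; rewrite ltNge (r_le n.+2).
Qed.

(* Once [mdist x (w x) < delta], the ball of radius [eps + delta] around [x] is
   mapped into itself by [w]. *)
Lemma iter_cauchy x (eps : R) : 0 < eps ->
  exists n, forall k, mdist (iter n w x) (iter (k + n) w x) < eps.
Proof.
move=> eps0; have e20 : 0 < eps / 2 by rewrite divr_gt0.
have [delta delta0 mk] := w_mk e20.
have m0 : 0 < Num.min delta (eps / 2) by rewrite lt_min delta0.
have [n] := iter_mdist_lt x (w x) m0.
rewrite -iterSr /= => dn; exists n => k.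
suff : mdist (iter n w x) (iter (k + n) w x) < eps / 2 + Num.min delta (eps / 2).
  by move/lt_le_trans; apply; rewrite [leRHS](splitr eps) lerD2l ge_min lexx orbT.
elim: k => [|k IH]; first by rewrite mdistxx addr_gt0.
rewrite addSn /=; apply: le_lt_trans (metric_triangle _ (w (iter n w x)) _) _.
rewrite addrC ler_ltD//; apply: mk.
by apply: (lt_le_trans IH); rewrite lerD2l ge_min lexx.
Qed.

Lemma iter_cvg_compact p (A : set X) (eps : R) : w p = p ->
    continuous w -> compact A -> 0 < eps ->
  \forall n \near \oo, forall x, A x -> mdist (iter n w x) p < eps.
Proof.
move=> wp cw /compact_near_coveringP cA eps0.
have iter_p n : iter n w p = p by elim: n => //= n ->.
have c_iter n : continuous (iter n w).
  elim: n => [|n IH] x; first exact: cvg_id.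
  by apply: continuous_comp; [exact: IH | exact: cw].
apply: (cA nat \oo (fun n x => mdist (iter n w x) p < eps)) => x Ax.
have [N] := iter_mdist_lt x p eps0; rewrite iter_p => xN.
(* By continuity of [iter N w], points near [x] are also within [eps] of [p] at time [N]; they stay
   so later because distances to the fixed point never grow. *)
exists ([set y | mdist (iter N w y) p < eps], [set n | (N <= n)%N]).
  split; last by exists N.
  have := @metricType_numDomainType.cvgr_dist_lt _ _ _ _ _ _ _ (c_iter N x).
  move=> /(_ _ (eps - mdist (iter N w x) p)); rewrite subr_gt0 => /(_ xN).
  apply: filterS => y /=; rewrite ltrBrDr metric_sym.
  exact/le_lt_trans/metric_triangle.
move=> [y n] [/= yN Nn]; apply: le_lt_trans yN.
by rewrite -{1}(iter_p n) -{2}(iter_p N); exact: shrinking_iter_le.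
Qed.

End Iterates.

Lemma meir_keeler_fixpoint (X : completeMetricType R) (w : X -> X) :
  continuous w -> shrinking w -> meir_keeler w -> exists p, w p = p.
Proof.
move=> cw ws wmk; pose u n := iter n w (point : X).
have /cauchy_cvg/cvg_ex[p up] : cauchy (u @ \oo).
  apply: cauchy_exP => eps eps0.
  have [n un] := iter_cauchy ws wmk point eps0.
  exists (u n), n => // k /= /subnK <-; rewrite ballEmdist; exact: un.
exists p.
have hX : hausdorff_space X by exact: metric_hausdorff.
have uwp : u n.+1 @[n --> \oo] --> w p by exact: continuous_cvg (cw p) up.
have up1 : u n.+1 @[n --> \oo] --> p by rewrite cvg_shiftS.
exact: (cvg_unique hX uwp up1).
Qed.

End MeirKeeler.

Lemma hausdorff_dist_set1_ge0 (R : realType) (X : metricType R) (A : set X) p :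
  A !=set0 -> 0 <= hausdorff_dist A [set p].
Proof.
move=> [a Aa]; rewrite le_max; apply/orP; right.
rewrite /excess image_set1 sup1; apply: lb_le_inf; first by exists (mdist p a), a.
by move=> _ [y _ <-]; exact: mdist_ge0.
Qed.

(** One excess becomes a supremum of distances to [p], the other an infimum, bounded by its value at
    any one point of [A]. *)
Lemma hausdorff_dist_set1_le (R : realType) (X : metricType R) (A : set X) p
    (eps : R) :
  A !=set0 -> (forall x, A x -> mdist x p <= eps) ->
  hausdorff_dist A [set p] <= eps.
Proof.
move=> [a Aa] Ap; rewrite ge_max; apply/andP; split.
  apply: ge_sup; first by exists (inf [set mdist a y | y in [set p]]), a.
  by move=> _ [x Ax <-]; rewrite image_set1 inf1; exact: Ap.
rewrite /excess image_set1 sup1; apply: (@le_trans _ _ (mdist p a)).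
  by apply: ge_inf; [exists 0 => _ [y _ <-]; exact: mdist_ge0 | exists a].
by rewrite metric_sym; exact: Ap.
Qed.

(** The points [s] and [t] are independent, so that [phi] at [mdist x y] can be compared with [psi]
    at [mdist (w x) (w y)]. *)
Lemma limf_esup_lt_einf (T : choiceType) (X : filteredType T) (R : realType)
    (f g : X -> \bar R) (F : set_system X) : Filter F ->
  (limf_esup f F < limf_einf g F)%E ->
  exists2 V, F V & forall s t, V s -> V t -> (f s < g t)%E.
Proof.
move=> FF; rewrite limf_einfE limf_esupE.
move=> /ereal_sup_gt[_ [V FV <-]] /ereal_inf_lt[_ [U FU <-]] UV.
exists (U `&` V); first exact: filterI.
move=> s t [Us _] [_ Vt]; apply: (@le_lt_trans _ _ (ereal_sup (f @` U))).
  by apply: ereal_sup_ubound; exists s.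
by apply: (lt_le_trans UV); apply: ereal_inf_lbound; exists t.
Qed.

Theorem theorem4p2 (R : realType) (X : completeMetricType R)
    (psi phi : R -> R)
    (psi_nd : {in `]0, +oo[ &, nondecreasing_fun psi})
    (phi_nd : {in `]0, +oo[ &, nondecreasing_fun phi})
    (w : X -> X) (w_continuous : continuous w)
    (w_contraction : forall x y : X, 0 < mdist (w x) (w y) ->
      psi (mdist (w x) (w y)) <= phi (mdist x y))
    (phi_lt_psi : forall t : R, 0 < t -> phi t < psi t)
    (psi_bounded : forall eps : R, 0 < eps ->
      (-oo < ereal_inf [set (psi t)%:E | t in `]eps, +oo[])%E)
    (psi_phi_seq : forall (t : nat -> R) (l : R),
      (forall n, 0 < t n) ->
      psi (t n) @[n --> \oo] --> l ->
      phi (t n) @[n --> \oo] --> l ->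
      decreasing_seq (fun n => psi (t n)) ->
      t n @[n --> \oo] --> 0)
    (phi_psi_right : forall eps : R, 0 < eps ->
      (limf_esup (fun t => (phi t)%:E) eps^'+ <
       limf_einf (fun t => (psi t)%:E) eps^'+)%E) :
  exists Astar : set X,
    unique (attractor w) Astar /\
    forall A : set X, hyperspace A ->
      (forall n, hyperspace (iter n w @` A)) /\
      hausdorff_dist (iter n w @` A) Astar @[n --> \oo] --> 0.
Proof.
have ws : shrinking w.
  (* Otherwise [psi (mdist (w x) (w y))] is at most [phi (mdist x y)], hence below
     [psi (mdist x y)], against the monotonicity of [psi]. *)
  move=> x y xy; have [//|yx] := ltP.
  have xy0 : 0 < mdist x y by rewrite mdist_gt0.
  have wxy0 := lt_le_trans xy0 yx.
  have := le_lt_trans (w_contraction _ _ wxy0) (phi_lt_psi _ xy0).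
  by rewrite ltNge psi_nd// in_itv/= andbT.
have wmk : meir_keeler w.
  move=> eps eps0.
  have [V + phi_psi] := limf_esup_lt_einf _ (phi_psi_right _ eps0).
  move=> [delta /= delta0 epsV]; exists delta => // x y xy.
  have memV z : eps < z -> z < eps + delta -> V z.
    move=> ez zd; apply: epsV => //=.
    by rewrite distrC gtr0_norm ?subr_gt0// ltrBlDl.
  (* Were [mdist (w x) (w y)] above [eps], both distances would lie in []eps, eps + delta[], hence
     in [V], where [phi_psi] contradicts the contraction. *)
  rewrite leNgt; apply/negP => ewxy.
  have exy := lt_le_trans ewxy (shrinking_le ws x y).
  have := w_contraction _ _ (lt_trans eps0 ewxy).
  rewrite leNgt -lte_fin phi_psi//; apply: memV => //.
  exact: le_lt_trans (shrinking_le ws x y) xy.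
have [p wp] := meir_keeler_fixpoint w_continuous ws wmk.
have iter_hyp A n : hyperspace A -> hyperspace (iter n w @` A).
  move=> [A0 cA]; elim: n => [|n [[a An] cn]]; first by rewrite image_id.
  have -> : iter n.+1 w @` A = w @` (iter n w @` A) by rewrite -image_comp.
  split; first by exists (w a), a.
  by apply: continuous_compact => //; exact: continuous_subspaceT.
exists [set p]; split.
  split; first by split; [split; [exists p|exact: compact_set1] | rewrite image_set1 wp].
  move=> A [[[a Aa] cA] wA].
  have iterA n : iter n w @` A = A.
    by elim: n => [|n IH]; [rewrite image_id | rewrite -[RHS]wA -[in RHS]IH -image_comp].
  have Ap x : A x -> x = p.
    (* Uniform convergence is used with radius [mdist x p]: as [A] is its own [N]-th image, [x] is
       some [iter N w z], and would be closer to [p] than itself. *)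
    move=> Ax; apply/eqP; rewrite -[_ == _]negbK -mdist_gt0; apply/negP => xp0.
    have [N _ /(_ _ (leqnn N)) /= AN] :=
      iter_cvg_compact ws wmk wp w_continuous cA xp0.
    move: (Ax) AN; rewrite -{1}(iterA N) => -[z Az <-] /(_ _ Az).
    by rewrite ltxx.
  by apply/seteqP; split=> [_ ->|x /Ap//]; rewrite -(Ap _ Aa).
move=> A hA; split=> [n|]; first exact: iter_hyp.
apply/cvgrPdist_le => eps eps0.
have := iter_cvg_compact ws wmk wp w_continuous hA.2 eps0.
apply: filterS => n An; have [n0 _] := iter_hyp _ n hA.
rewrite sub0r normrN ger0_norm; last exact: hausdorff_dist_set1_ge0.
by apply: hausdorff_dist_set1_le => // _ [x Ax <-]; exact/ltW/An.
Qed.
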